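(* Formulation F6 is equivalent to Formulation F4 (both defined in the context). Explicitly: for every instance $(T,M,(W_m)_{m\in M})$, a pair $(X,S)$ is a continuous solution of F4 if and only if $S$ is a continuous solution of F6 and $X_{t,m}=\sum_{t'=t-W_m+1}^{t}S_{t',m}$ for all $t\in T$, $m\in M$.
   Context: An instance of the generator maintenance scheduling problem consists of a horizon $T=\{1,2,\dots,|T|\}$ of periods, a finite nonempty set $M$ of maintenances, and a positive integer duration $W_m$ for each $m\in M$. The variables are $X_{t,m}$ (maintenance $m$ is executed in period $t$) and $S_{t,m}$ (maintenance $m$ starts in period $t$), for $t\in T$, $m\in M$. Convention: $S_{t,m}=0$ whenever $t\le 0$, $t>|T|$, or $t\ge |T|-W_m+2$ (a maintenance cannot start so late that it would not finish within the horizon). In particular every solution of either formulation is required to satisfy $S_{t,m}=0$ for $t\in T$ with $t\ge |T|-W_m+2$. Formulation F4 (variables $X,S$): $\sum_{t\in T}X_{t,m}=W_m$ for all $m\in M$; $\sum_{t\in T}S_{t,m}=1$ for all $m\in M$; $\sum_{t'=t-W_m+1}^{t}S_{t',m}\ge X_{t,m}$ for all $t\in T$, $m\in M$; $X_{t,m},S_{t,m}\in\{0,1\}$ for all $t\in T$, $m\in M$. Formulation F6 (variables $S$ only): $\sum_{t\in T}S_{t,m}=1$ for all $m\in M$; $S_{t,m}\in\{0,1\}$ for all $t\in T$, $m\in M$. In F6 the execution variable is not explicit: the expression $\sum_{t'=t-W_m+1}^{t}S_{t',m}$ is used wherever $X_{t,m}$ would appear. A continuous solution of a formulation is a real assignment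 of its variables satisfying its linear relaxation, i.e. all its constraints with each condition ''$\in\{0,1\}$'' replaced by ''$\in[0,1]$''. A formulation A is at least as tight as B if all continuous solutions satisfying A also satisfy B; A is equivalent to B if A is at least as tight as B and B is at least as tight as A. A pair $(X,S)$ is regarded as satisfying F6 when $S$ is a continuous solution of F6 and $X$ is given by the expression above. *)

(* Defs.v *)
From HB Require Import structures.
From mathcomp Require Import all_boot all_order all_algebra.

Set Implicit Arguments.
Unset Strict Implicit.
Unset Printing Implicit Defensive.

Import Order.TTheory GRing.Theory Num.Theory.
Local Open Scope ring_scope.

Section MaintenanceScheduling.

Variables (R : realFieldType) (n : nat) (M : finType) (W : M -> nat).

(* The horizon is T = {1, ..., n}; the ordinal t : 'I_n stands for the      *)
(* period t.+1.                                                             *)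
Definition period (t : 'I_n) : int := t.+1%:Z.

Definition assignment := {ffun 'I_n * M -> R}.

(* S_{z,m} for an arbitrary integer z: zero when z <= 0 or z > n.           *)
Definition start_at (S : assignment) (z : int) (m : M) : R :=
  if z is Posz k.+1 then oapp (fun t : 'I_n => S (t, m)) 0 (insub k) else 0.

(* \sum_{t' = t - W_m + 1}^{t} S_{t',m}, indexed by k = t - t'.             *)
Definition window_sum (S : assignment) (t : 'I_n) (m : M) : R :=
  \sum_(k < W m) start_at S (period t - k%:Z) m.

(* The convention S_{t,m} = 0 for periods t >= |T| - W_m + 2. The           *)
(* subtraction is in int, hence not truncated when W_m > |T| + 2.           *)
Definition no_late_start (S : assignment) : Prop :=
  forall (t : 'I_n) (m : M), n%:Z - (W m)%:Z + 2 <= period t -> S (t, m) = 0.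

(* A formulation in the variables (X, S) is parametrized by the domain of   *)
(* its variables: {0, 1} for the integer program, [0, 1] for its linear     *)
(* relaxation.                                                              *)
Definition formulation := pred R -> assignment -> assignment -> Prop.

Definition binary : pred R := fun x => (x == 0) || (x == 1).
Definition unit_interval : pred R := fun x => 0 <= x <= 1.

Definition F4 : formulation := fun D X S =>
  [/\ forall m : M, \sum_(t < n) X (t, m) = (W m)%:R,
      forall m : M, \sum_(t < n) S (t, m) = 1,
      forall (t : 'I_n) (m : M), window_sum S t m >= X (t, m),
      forall (t : 'I_n) (m : M), D (X (t, m)) /\ D (S (t, m))
    & no_late_start S].

Definition F6_start (D : pred R) (S : assignment) : Prop :=
  [/\ forall m : M, \sum_(t < n) S (t, m) = 1,
      forall (t : 'I_n) (m : M), D (S (t, m))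
    & no_late_start S].

(* F6 has no variable X; a pair (X, S) is regarded as satisfying it when S  *)
(* does and X is the expression that replaces it.                           *)
Definition F6 : formulation := fun D X S =>
  F6_start D S /\ forall (t : 'I_n) (m : M), X (t, m) = window_sum S t m.

Definition integer_solution (A : formulation) (X S : assignment) : Prop :=
  A binary X S.

Definition continuous_solution (A : formulation) (X S : assignment) : Prop :=
  A unit_interval X S.

Definition at_least_as_tight (A B : formulation) : Prop :=
  forall X S : assignment, continuous_solution A X S -> continuous_solution B X S.

Definition equivalent (A B : formulation) : Prop :=
  at_least_as_tight A B /\ at_least_as_tight B A.

End MaintenanceScheduling.

(* Main.v *)
Require Import Defs.
From HB Require Import structures.
From mathcomp Require Import all_boot all_order all_algebra.
From mathcomp Require Import zify.

(** Let [w t] be the sum of the starts of [m] over the window of [W m] periods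
    ending at [t], which is what F6 puts in place of [X (t, m)] and F4 only
    uses as an upper bound on it.  Both directions rest on the identity
    [\sum_t w t = W m] ([sum_window_sum]): exchanging the sums, each start [s]
    is counted once in each of the periods [s, ..., s + W m - 1], and all of
    these lie within the horizon unless the start is late, in which case it
    carries no weight.

    From F6 to F4, the identity is the duration constraint, and [w t] lies in
    [0, 1] because it adds up distinct nonnegative terms of a sum equal to 1
    ([window_sum_unit]).  From F4 to F6, the numbers [w t - X (t, m)] are
    nonnegative and add up to [W m - W m = 0], so all of them vanish. *)

Set Implicit Arguments.
Unset Strict Implicit.
Unset Printing Implicit Defensive.

Import Order.TTheory GRing.Theory Num.Theory.
Local Open Scope ring_scope.

Lemma sum_ord_eq (V : nmodType) (n j : nat) (x : V) :
  \sum_(i < n | i == j :> nat) x = if (j < n)%N then x else 0.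
Proof.
case: ifPn => [ltjn | lenj]; first by rewrite (big_pred1 (Ordinal ltjn)).
rewrite big_pred0 // => i; apply: contraNF lenj => /eqP <-.
exact: ltn_ord.
Qed.

Section WindowSum.

Variables (R : realFieldType) (n : nat) (M : finType) (W : M -> nat).
Variable S : assignment R n M.

(** Writing the out-of-range convention as a filtered sum over the horizon
    makes the window sum a double sum, whose order can be exchanged. *)
Lemma start_at_shift (t : 'I_n) (k : nat) (m : M) :
  start_at S (period t - k%:Z) m = \sum_(s < n | (s + k)%N == t :> nat) S (s, m).
Proof.
rewrite /period; case: (leqP k t) => [lekt | lttk].
  have -> : t.+1%:Z - k%:Z = Posz (t - k).+1 by lia.
  have lttkn : (t - k < n)%N by apply: leq_ltn_trans (leq_subr _ _) (ltn_ord t).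
  rewrite /start_at insubT /= (big_pred1 (Ordinal lttkn)) // => s.
  rewrite /= -val_eqE /=; lia.
rewrite big_pred0 => [|s]; last by lia.
have : t.+1%:Z - k%:Z <= 0 by lia.
by case: (_ - _) => [[|j]|j].
Qed.

(** A start that is not late leaves room for all [W m] periods, so exactly one
    period [t] of the horizon is [s + k]; a late start has weight zero, which
    makes the missing period harmless. *)
Lemma start_weight_shift (m : M) (k : nat) (s : 'I_n) :
  no_late_start W S -> (k < W m)%N ->
  \sum_(t < n | (s + k)%N == t :> nat) S (s, m) = S (s, m).
Proof.
move=> late ltkW; under eq_bigl do rewrite eq_sym.
rewrite sum_ord_eq; case: ifPn => // lensk.
by rewrite late // /period; lia.
Qed.

Lemma sum_window_sum (m : M) : no_late_start W S ->
  \sum_(t < n) S (t, m) = 1 -> \sum_(t < n) window_sum W S t m = (W m)%:R.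
Proof.
move=> late S1; rewrite /window_sum exchange_big /=.
transitivity (\sum_(k < W m) (1 : R)); last by rewrite sumr_const card_ord.
apply: eq_bigr => k _; under eq_bigr do rewrite start_at_shift.
rewrite (exchange_big_dep predT) //= -S1.
by apply: eq_bigr => s _; rewrite start_weight_shift.
Qed.

(** Each start meets the window at no more than one offset, so the window sum
    is bounded by the sum of all starts. *)
Lemma window_sum_unit (t : 'I_n) (m : M) :
  \sum_(s < n) S (s, m) = 1 -> (forall s, 0 <= S (s, m)) ->
  0 <= window_sum W S t m <= 1.
Proof.
move=> S1 S0; rewrite /window_sum.
under eq_bigr do rewrite start_at_shift.
apply/andP; split; first by apply: sumr_ge0 => k _; apply: sumr_ge0.
rewrite (exchange_big_dep predT) //= -S1; apply: ler_sum => s _.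
case: (leqP s t) => [lest | ltts]; last by rewrite big_pred0 // => k; lia.
rewrite (eq_bigl (fun k : 'I_(W m) => k == (t - s)%N :> nat)) => [|k]; last by lia.
by rewrite sum_ord_eq; case: ifP.
Qed.

End WindowSum.

Theorem corollary3p4 (R : realFieldType) (n : nat) (M : finType) (W : M -> nat)
    (hM : (0 < #|M|)%N) (hW : forall m : M, (0 < W m)%N) :
  equivalent (@F6 R n M W) (@F4 R n M W).
Proof.
split=> X S.
  case=> -[S1 S01 late] XE; split=> // [m | t m | t m].
  - by under eq_bigr do rewrite XE; apply: sum_window_sum.
  - by rewrite XE.
  - split=> //; rewrite XE; apply: window_sum_unit => // s.
    by case/andP: (S01 s m).
case=> XW S1 XleW XS01 late; split.
  by split=> // t m; case: (XS01 t m).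
move=> t m; apply/esym/eqP; rewrite -subr_eq0; apply/eqP.
have gap_ge0 s : true -> 0 <= window_sum W S s m - X (s, m).
  by rewrite subr_ge0.
apply: (psumr_eq0P gap_ge0) => //.
by rewrite sumrB XW sum_window_sum // subrr.
Qed.
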